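(* Let $R$ be an integral domain that is not a field. Then the Macías topology on $R^0=R\setminus\{0\}$ is strictly coarser than the Golomb topology on $R^0$; that is, every open set of $M(R)$ is open in $G(R)$, and some open set of $G(R)$ is not open in $M(R)$.
   Context: For $r\in R$ let $\sigma_r:=\{s\in R: \langle r\rangle+\langle s\rangle=R\}$, where $\langle r\rangle$ is the ideal generated by $r$. Write $R^0=R\setminus\{0\}$ and $\sigma_k^0=\sigma_k\setminus\{0\}$. The Macías space $M(R)$ is the set $R^0$ with the topology (the Macías topology) having basis $\{\sigma_k^0: k\in R^0\}$. $\widetilde{G(R)}$ is the set $R$ with the topology generated by the collection of coprime cosets, i.e. cosets $x+I$ with $x\in R$, $I$ a nonzero ideal of $R$, and $\langle x\rangle+I=R$. The Golomb space $G(R)$ is $R^0$ with the subspace topology (the Golomb topology) from $\widetilde{G(R)}$. *)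

(* Defs.v *)
From HB Require Import structures.
From mathcomp Require Import all_boot all_order all_algebra.
From mathcomp Require Import all_classical.
From mathcomp Require Import topology.

Set Implicit Arguments.
Unset Strict Implicit.
Unset Printing Implicit Defensive.

Import GRing.Theory.
Local Open Scope classical_set_scope.
Local Open Scope ring_scope.

Section Ideals.
Variable R : idomainType.
Implicit Types (I J : set R) (r s x : R).

(* The improper ideal [setT] is allowed, unlike in [ring_quotient.idealr]. *)
Definition ideal I : Prop :=
  [/\ I 0, (forall x y, I x -> I y -> I (x + y))
         & (forall a x, I x -> I (a * x))].

Definition principal r : set R := smallest ideal [set r].

Definition ideal_add I J : set R := [set x + y | x in I & y in J].

Definition coset x I : set R := [set x + y | y in I].

Definition nonzero : set R := [set x | x != 0].

Definition sigma r : set R :=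
  [set s | ideal_add (principal r) (principal s) = setT].

(* The set sigma_r \ {0}, as a subset of the type of nonzero elements. *)
Definition sigma0 r : set nonzero := set_val @^-1` sigma r.

Definition macias_basis : set (set nonzero) := [set sigma0 k | k in nonzero].

Definition coprime_cosets : set (set R) :=
  [set A | exists x I, [/\ ideal I, I <> [set 0],
     ideal_add (principal x) I = setT & A = coset x I]].

Lemma principalP r x : principal r x <-> exists a, x = a * r.
Proof.
split=> [|[a ->]].
  apply: (@smallest_sub _ ideal [set r] [set y | exists a, y = a * r]).
    split => /=.
    - by exists 0; rewrite mul0r.
    - by move=> _ _ [a ->] [b ->]; exists (a + b); rewrite mulrDl.
    - by move=> c _ [a ->]; exists (c * a); rewrite mulrA.
  by move=> _ ->; exists 1; rewrite mul1r.
by move=> J [[_ _ JM] rJ]; apply: JM; apply: rJ.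
Qed.

Lemma sigmaP r s : sigma r s <-> exists a b, a * r + b * s = 1.
Proof.
split=> [/= rs|[a [b ab1]]].
  have : ideal_add (principal r) (principal s) 1 by rewrite rs.
  by case=> _ /principalP[a ->] [_ /principalP[b ->] ab1]; exists a, b.
apply/seteqP; split=> // x _; exists ((x * a) * r).
  by apply/principalP; exists (x * a).
exists ((x * b) * s); first by apply/principalP; exists (x * b).
by rewrite -!mulrA -mulrDr ab1 mulr1.
Qed.

Lemma macias_basis_cover : \bigcup_(A in macias_basis) A = setT.
Proof.
apply/seteqP; split=> // x _; exists (sigma0 1).
  by exists 1 => //=; exact: oner_neq0.
by apply/sigmaP; exists 1, 0; rewrite mul0r addr0 mulr1.
Qed.

Lemma macias_basis_join (A B : set nonzero) (t : nonzero) :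
    macias_basis A -> macias_basis B -> A t -> B t ->
  exists C, [/\ macias_basis C, C t & C `<=` A `&` B].
Proof.
move=> [k k0 <-] [l l0 <-] /sigmaP[a [b kt]] /sigmaP[c [d lt]].
exists (sigma0 (k * l)); split.
- by exists (k * l) => //=; exact: mulf_neq0.
- apply/sigmaP; exists (a * c), (a * k * d + b * (c * l + d * set_val t)).
  rewrite lt mulr1 mulrDl addrA mulrACA -(mulrA (a * k)) -mulrDr lt mulr1.
  exact: kt.
- move=> u /sigmaP[e [f klu]]; split; apply/sigmaP.
  + by exists (e * l), f; rewrite -mulrA (mulrC l).
  + by exists (e * k), f; rewrite -mulrA.
Qed.

End Ideals.

Definition macias_space (R : idomainType) : Type := @nonzero R.
HB.instance Definition _ (R : idomainType) := Choice.on (macias_space R).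
HB.instance Definition _ (R : idomainType) :=
  @isBaseTopological.Build (macias_space R) (set (macias_space R))
    (@macias_basis R) id (@macias_basis_cover R) (@macias_basis_join R).

Definition golomb_ambient (R : idomainType) : Type := R.
HB.instance Definition _ (R : idomainType) := Choice.on (golomb_ambient R).
HB.instance Definition _ (R : idomainType) :=
  @isSubBaseTopological.Build (golomb_ambient R) (set (golomb_ambient R))
    (@coprime_cosets R) id.

(* [set_type] of a set in a topological space carries the topology induced by
   [set_val], i.e. the genuine subspace topology. *)
Definition golomb_space (R : idomainType) : Type :=
  set_type (@nonzero R : set (golomb_ambient R)).
HB.instance Definition _ (R : idomainType) :=
  Topological.on (golomb_space R).

(* Main.v *)
(** A basic Macías set [sigma_k] contains with [s] the whole coprime coset
    [s + (k)], so it is Golomb open.  On the other hand every nonempty Macías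
    open set contains [1], whereas for [r] neither zero nor a unit the coset
    [1 + r + (r^2)], coprime because [(1 - r)(1 + r) + r^2 = 1], is Golomb open
    and avoids [1]. *)
Require Import Defs.
From mathcomp Require Import all_boot all_order all_algebra.
From mathcomp Require Import all_classical topology.
From mathcomp Require Import ring.

Import GRing.Theory.
Local Open Scope classical_set_scope.
Local Open Scope ring_scope.

Lemma ideal_principal (R : idomainType) (r : R) : ideal (principal r).
Proof.
split.
- by apply/principalP; exists 0; rewrite mul0r.
- move=> x y /principalP[a ->] /principalP[b ->].
  by apply/principalP; exists (a + b); rewrite mulrDl.
- by move=> c x /principalP[a ->]; apply/principalP; exists (c * a); rewrite mulrA.
Qed.

(** Coprimality to [k] depends only on the residue modulo [k]: in a Bezout identity
    [a * k + b * s = 1], the shift of [s] by [c * k] is absorbed by replacing [a] with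
    [a - b * c]. *)
Lemma sigma_coset (R : idomainType) (k s : R) :
  sigma k s -> coset s (principal k) `<=` sigma k.
Proof.
move=> /sigmaP[a [b ab1]] _ [_ /principalP[c ->] <-].
by apply/sigmaP; exists (a - b * c), b; rewrite -ab1; ring.
Qed.

Lemma coprime_coset_principal (R : idomainType) (k x : R) :
  k != 0 -> sigma k x -> coprime_cosets (coset x (principal k)).
Proof.
move=> k0 /sigmaP[a [b ab1]]; exists x, (principal k); split=> //.
- exact: ideal_principal.
- move=> I0; have : principal k k by apply/principalP; exists 1; rewrite mul1r.
  by rewrite I0 => /eqP; rewrite (negbTE k0).
(* The coprimality condition is [sigma x k] unfolded, so the two Bezout coefficients only trade
   places. *)
- by apply/sigmaP; exists b, a; rewrite addrC.
Qed.

Lemma golomb_ambient_open_coset (R : idomainType) (A : set R) :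
  coprime_cosets A -> @open (golomb_ambient R) A.
Proof.
(* Opens are unions of finite intersections of subbasic sets; here both the union and the
   intersection have the single member [A]. *)
move=> cA; exists [set A]; last by rewrite bigcup_set1.
by move=> _ ->; exact: (@finI_from1 _ _ _ id).
Qed.

Lemma golomb_open_preimage (R : idomainType) (A : set R) :
  @open (golomb_ambient R) A ->
  @open (golomb_space R) (set_val @^-1` A : set (@nonzero R)).
Proof. by move=> oA; exists A. Qed.

Lemma golomb_ambient_open_sigma (R : idomainType) (k : R) :
  k != 0 -> @open (golomb_ambient R) (sigma k).
Proof.
move=> k0; have -> : sigma k = \bigcup_(s in sigma k) coset s (principal k).
  apply/seteqP; split=> [s ks|x [s ks]]; last exact: sigma_coset.
  exists s => //; exists 0; last by rewrite addr0.
  by case: (ideal_principal R k).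
apply: (@bigcup_open (golomb_ambient R)) => s ks.
exact/golomb_ambient_open_coset/coprime_coset_principal.
Qed.

Lemma macias_open_golomb (R : idomainType) (U : set (@nonzero R)) :
  @open (macias_space R) U -> @open (golomb_space R) U.
Proof.
move=> [D DB <-]; apply: (@bigcup_open (golomb_space R)) => A /DB[k k0 <-].
exact/golomb_open_preimage/golomb_ambient_open_sigma.
Qed.

(** Since [0 * k + 1 * 1 = 1], the element 1 lies in every basic set; the point [u] serves to supply
    one basic set inside [U]. *)
Lemma macias_open_one (R : idomainType) (U : set (@nonzero R)) (u v : @nonzero R) :
  @open (macias_space R) U -> U u -> set_val v = 1 -> U v.
Proof.
move=> [D DB <-] [A DA Au] v1; exists A => //.
have [k _ <-] := DB _ DA.
by apply/sigmaP; exists 0, 1; rewrite v1 mul0r mul1r add0r.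
Qed.

Theorem corollary2p9 (R : idomainType) (notfield : ~ GRing.field_axiom R) :
  (forall U : set (@nonzero R),
     @open (macias_space R) U -> @open (golomb_space R) U) /\
  (exists U : set (@nonzero R),
     @open (golomb_space R) U /\ ~ @open (macias_space R) U).
Proof.
split=> [U|]; first exact: macias_open_golomb.
have [r [r0 ru]] : exists r : R, r != 0 /\ r \isn't a GRing.unit.
  apply: contrapT => nex; apply: notfield => r r0.
  by apply: contrapT => /negP ru; apply: nex; exists r.
pose A := coset (1 + r) (principal (r ^+ 2)).
have nzP (x : R) : x != 0 -> x \in @nonzero R by move=> x0; exact/mem_set.
(* Otherwise [r] would be the unit [-1]. This makes the centre of the coset a point of the space, so
   that the trace of [A] is nonempty. *)
have r1 : 1 + r != 0.
  apply: contraNneq ru => /eqP; rewrite addrC addr_eq0 => /eqP ->.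
  by rewrite unitrN1.
have one0 : (1 : R) != 0 := oner_neq0 R.
pose one : @nonzero R := SigSub (nzP _ one0).
pose u : @nonzero R := SigSub (nzP _ r1).
exists (set_val @^-1` A); split.
  apply/golomb_open_preimage/golomb_ambient_open_coset.
  apply: coprime_coset_principal; first by rewrite expf_neq0.
  by apply/sigmaP; exists 1, (1 - r); ring.
move=> /(@macias_open_one _ _ u one) [].
- by exists 0; rewrite ?addr0//; case: (ideal_principal R (r ^+ 2)).
- by [].
(* If [1 = 1 + r + a * r ^+ 2], cancelling the nonzero factor [r] leaves [1 + a * r = 0], so [- a]
   inverts [r]. *)
move=> _ /principalP[a ->] e; move/negP: ru; apply.
have /eqP : r * (1 + a * r) = 0.
  have -> : r * (1 + a * r) = (1 + r + a * r ^+ 2) - 1 by ring.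
  by apply/eqP; rewrite subr_eq0 e.
rewrite mulf_eq0 (negbTE r0) /= addr_eq0 => /eqP ar.
by apply/unitrPr; exists (- a); rewrite mulrN mulrC.
Qed.
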